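(* Let $\circledast,\odot$ be proper multiplications on $\mathbb{Z}^d$. The classes $\mathcal{PS}^*(\circledast)$ and $\mathcal{PS}^*(\odot)$ of subsets of $\mathbb{Z}^d_{\neq 0}$ are equal if and only if there exist $v,w\in\mathbb{Z}^d_{\neq 0}$ such that for all $x,y\in\mathbb{Z}^d_{\neq 0}$, \[x\circledast v\circledast y = x\odot w\odot y.\]
   Context: A proper multiplication on $\mathbb{Z}^d$ is a binary operation $\circledast:\mathbb{Z}^d\times\mathbb{Z}^d\to\mathbb{Z}^d$ that makes the abelian group $(\mathbb{Z}^d,+)$ into an associative (not necessarily commutative or unital) ring $(\mathbb{Z}^d,+,\circledast)$ without zero divisors. Write $\mathbb{Z}^d_{\neq 0}=\mathbb{Z}^d\setminus\{0\}$; then $(\mathbb{Z}^d_{\neq 0},\circledast)$ is a semigroup. For a semigroup $(S,\cdot)$, $s\in S$ and $A\subseteq S$, let $s^{-1}\cdot A=\{t\in S: s\cdot t\in A\}$. A set $A\subseteq S$ is thick if for every finite $F\subseteq S$ there is $x\in S$ with $F\cdot x\subseteq A$; it is piecewise syndetic if there are $s_1,\dots,s_k\in S$ such that $s_1^{-1}\cdot A\cup\dots\cup s_k^{-1}\cdot A$ is thick. $\mathcal{PS}^*(\circledast)$ denotes the class of subsets of $\mathbb{Z}^d_{\neq 0}$ which have non-empty intersection with every piecewise syndetic subset of the semigroup $(\mathbb{Z}^d_{\neq 0},\circledast)$. *)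

(* Defs.v *)
From mathcomp Require Export all_boot all_order all_algebra.
From mathcomp Require Export boolp classical_sets functions cardinality.

Set Implicit Arguments.
Unset Strict Implicit.
Unset Printing Implicit Defensive.

Import GRing.Theory.
Local Open Scope ring_scope.
Local Open Scope classical_set_scope.

Record proper_mul (d : nat)
    (mul : 'rV[int]_d -> 'rV[int]_d -> 'rV[int]_d) : Prop := ProperMul {
  proper_mulA : associative mul;
  proper_mulDl : left_distributive mul +%R;
  proper_mulDr : right_distributive mul +%R;
  proper_mul_eq0 : forall x y, mul x y = 0 -> x = 0 \/ y = 0 }.

Definition nonzero_vecs (d : nat) : set 'rV[int]_d := [set x | x <> 0].

(* A semigroup is given by a carrier [S : set T] and an operation [op] on the
   ambient type [T], meant to be associative on [S] and to preserve [S]. *)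
Section Semigroup.
Variables (T : Type) (S : set T) (op : T -> T -> T).

Definition left_quotient (s : T) (A : set T) : set T :=
  [set t | S t /\ A (op s t)].

Definition thick (A : set T) : Prop :=
  forall F : set T, finite_set F -> F `<=` S ->
    exists2 x, S x & [set op f x | f in F] `<=` A.

Definition piecewise_syndetic (A : set T) : Prop :=
  exists (k : nat) (s : 'I_k -> T),
    (forall i, S (s i)) /\ thick (\bigcup_i left_quotient (s i) A).

Definition PSstar : set (set T) :=
  [set A | A `<=` S /\
    forall B, B `<=` S -> piecewise_syndetic B -> A `&` B !=set0].

End Semigroup.

(* Main.v *)
(* Write [L] and [L'] for the left multiplications of [m] and [o]; for nonzero
   vectors they are invertible over the rationals.  Up to rational factors, the
   condition on [v] and [w] says that [L] and [L'] have the same image.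

   If it holds, the identity rewrites [e f x] for [m], with [f] and [x] multiplied
   by [v] where needed, as a product for [o], which carries a witness of piecewise
   syndeticity over.  Conversely, let [F_n] be finite sets exhausting the nonzero
   vectors and let [A] be the union of the sets [m F_n x_n], which is thick for
   [m].  If [x_n] avoids finitely many proper subspaces and finitely many points
   depending on [x_0, ..., x_(n-1)], then [o (o e f) y = m p x] and
   [o (o e0 f0) y = m p0 x'] with large [x = x_n] and [x' = x_k] force [n = k] and
   [L'(e f) L'(e0 f0)^-1 = L(p) L(p0)^-1].  So if [A] is piecewise syndetic for
   [o], the vectors [f] are covered by the finitely many subspaces
   [L'(e)^-1 (L L'(e0 f0))] with [e], [e0] ranging over a finite set.  One of them
   is then the whole space, and this makes the image of [L'] equal to that
   of [L]. *)

From HB Require Import structures.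
Require Import Defs.

Set Implicit Arguments.
Unset Strict Implicit.
Unset Printing Implicit Defensive.

Import Order.TTheory GRing.Theory Num.Theory.

Local Open Scope ring_scope.
Local Open Scope classical_set_scope.

(** * Integer vectors and additive maps *)

Lemma rVint_neq0_ex d : (0 < d)%N -> exists x : 'rV[int]_d, x <> 0.
Proof.
case: d => // d _; exists (const_mx 1) => /rowP/(_ ord0).
by rewrite !mxE; apply/eqP/oner_neq0.
Qed.

Lemma rVint_mulrnI d n (x y : 'rV[int]_d) :
  (0 < n)%N -> x *+ n = y *+ n -> x = y.
Proof.
move=> n_gt0 /rowP eq_xy; apply/rowP => i.
by apply: (pmulrnI n_gt0); rewrite /= -!mulmxnE eq_xy.
Qed.

Lemma rVint_mulrn_eq0 d n (x : 'rV[int]_d) : (0 < n)%N -> x *+ n = 0 -> x = 0.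
Proof. by move=> n_gt0 xn0; apply: (rVint_mulrnI n_gt0); rewrite xn0 mul0rn. Qed.

Lemma rVint_mulrn_inj d (x : 'rV[int]_d) : x <> 0 -> injective (GRing.natmul x).
Proof.
move=> x0 s t /rowP eq_st; apply/eqP/negPn/negP => neq_st.
apply: x0; apply/rowP => k; have := eq_st k.
rewrite !mulmxnE mxE -[LHS]mulr_natr -[RHS]mulr_natr => eqk.
apply/eqP; apply: contraNT neq_st => xk0.
by rewrite -(eqr_nat int); apply/eqP; apply: (mulfI xk0).
Qed.

Lemma additive_rVint_matrix d (f : {additive 'rV[int]_d -> 'rV[int]_d}) y :
  f y = y *m \matrix_i f (delta_mx 0 i).
Proof.
rewrite {1}(row_sum_delta y) raddf_sum mulmx_sum_row; apply: eq_bigr => i _.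
by rewrite rowK -(intz (y 0 i)) !scaler_int raddfMz.
Qed.

(** Cramer's rule: the adjugate inverts the matrix of [f] up to its determinant, whose sign is moved
    into [y] so that [n] is positive. *)
Lemma injective_additive_quasi_surj d
    (f : {additive 'rV[int]_d -> 'rV[int]_d}) z :
  (forall y, f y = 0 -> y = 0) -> exists n y, (0 < n)%N /\ f y = z *+ n.
Proof.
move=> f_inj; set A := \matrix_i f (delta_mx 0 i).
have detA : \det A != 0.
  apply/negP => /det0P[y y_neq0 yA]; case/eqP: y_neq0; apply: f_inj.
  by rewrite additive_rVint_matrix.
exists `|\det A|%N, (z *m (sgz (\det A) *: \adj A)).
rewrite absz_gt0 detA; split=> //.
rewrite additive_rVint_matrix -/A -mulmxA -scalemxAl mul_adj_mx.
by rewrite scale_scalar_mx -abszEsg mul_mx_scalar -natz scaler_nat.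
Qed.

(** * Cancellation, unit and inverses up to integer factors *)

Section ProperMultiplication.

Variables (d : nat) (m : 'rV[int]_d -> 'rV[int]_d -> 'rV[int]_d).
Hypothesis hm : proper_mul m.

Local Notation V := 'rV[int]_d.

Let mulA : associative m := proper_mulA hm.

Lemma proper_mulBr x : zmod_morphism (m x).
Proof.
move=> y z; apply: (addIr (m x z)).
by rewrite -(proper_mulDr hm) !subrK.
Qed.

Lemma proper_mulBl y : zmod_morphism (m^~ y).
Proof.
move=> x z /=; apply: (addIr (m z y)).
by rewrite -(proper_mulDl hm) !subrK.
Qed.

Lemma proper_mulMnr x y n : m x (y *+ n) = m x y *+ n.
Proof.
pose f : {additive V -> V} :=
  HB.pack (m x) (GRing.isZmodMorphism.Build V V (m x) (@proper_mulBr x)).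
exact: (raddfMn f).
Qed.

Lemma proper_mulMnl x y n : m (x *+ n) y = m x y *+ n.
Proof.
pose f : {additive V -> V} :=
  HB.pack (m^~ y) (GRing.isZmodMorphism.Build V V (m^~ y) (@proper_mulBl y)).
exact: (raddfMn f).
Qed.

Lemma proper_mul0r x : m x 0 = 0.
Proof. by rewrite -(subrr 0) proper_mulBr !subrr. Qed.

Lemma proper_mul0l y : m 0 y = 0.
Proof. by rewrite -(subrr 0) (proper_mulBl y) !subrr. Qed.

Lemma proper_mul_neq0 x y : x <> 0 -> y <> 0 -> m x y <> 0.
Proof. by move=> x0 y0 /(proper_mul_eq0 hm)[/x0|/y0]. Qed.

Lemma proper_mul_eq0r a y : a <> 0 -> m a y = 0 -> y = 0.
Proof. by move=> a0 /(proper_mul_eq0 hm)[]. Qed.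

Lemma proper_mul_eq0l a y : a <> 0 -> m y a = 0 -> y = 0.
Proof. by move=> a0 /(proper_mul_eq0 hm)[]. Qed.

Lemma proper_mulIr a : a <> 0 -> injective (m a).
Proof.
move=> a0 x y eq_xy; apply/eqP; rewrite -subr_eq0; apply/eqP.
by apply: (proper_mul_eq0r a0); rewrite proper_mulBr eq_xy subrr.
Qed.

Lemma proper_mulIl a : a <> 0 -> injective (m^~ a).
Proof.
move=> a0 x y /= eq_xy; apply/eqP; rewrite -subr_eq0; apply/eqP.
by apply: (proper_mul_eq0l a0); rewrite (proper_mulBl a) eq_xy subrr.
Qed.

Lemma proper_mul_solver a z :
  a <> 0 -> exists n y, (0 < n)%N /\ m a y = z *+ n.
Proof.
move=> a0; pose f : {additive V -> V} :=
  HB.pack (m a) (GRing.isZmodMorphism.Build V V (m a) (@proper_mulBr a)).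
by apply: (@injective_additive_quasi_surj _ f) => y /(proper_mul_eq0r a0).
Qed.

Lemma proper_mul_solvel a z :
  a <> 0 -> exists n y, (0 < n)%N /\ m y a = z *+ n.
Proof.
move=> a0; pose f : {additive V -> V} :=
  HB.pack (m^~ a) (GRing.isZmodMorphism.Build V V (m^~ a) (@proper_mulBl a)).
by apply: (@injective_additive_quasi_surj _ f) => y /(proper_mul_eq0l a0).
Qed.

(** Over the rationals, [u] is [n] times the identity. Every [x] has a multiple of the form [m a y],
    so [m u a = a *+ n] fixes the left action of [u]; cancelling [u] gives the right action. *)
Lemma proper_mul_quasi_unit (a : V) : a <> 0 -> exists (u : V) n,
  [/\ (0 < n)%N, u <> 0, forall x, m u x = x *+ n & forall x, m x u = x *+ n].
Proof.
move=> a0; have [n [u [n_gt0 ua]]] := proper_mul_solvel a a0.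
have ul x : m u x = x *+ n.
  have [k [y [k_gt0 ay]]] := proper_mul_solver x a0.
  apply: (rVint_mulrnI k_gt0).
  by rewrite -proper_mulMnr -ay mulA ua proper_mulMnl ay mulrnAC.
have u0 : u <> 0.
  move=> u0; apply: a0; apply: (rVint_mulrn_eq0 n_gt0).
  by rewrite -ua u0 proper_mul0l.
exists u, n; split=> // x; apply: (proper_mulIl u0) => /=.
by rewrite -mulA ul proper_mulMnr proper_mulMnl.
Qed.

(** A left inverse of [a] is also a right inverse because [m a] is surjective up to integer
    factors. *)
Lemma proper_mul_quasi_inv (a : V) : a <> 0 -> exists (b : V) n,
  [/\ (0 < n)%N, b <> 0, forall x, m a (m b x) = x *+ n
    & forall x, m b (m a x) = x *+ n].
Proof.
move=> a0; have [u [k [k_gt0 u0 ul _]]] := proper_mul_quasi_unit a0.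
have [l [b [l_gt0 ba]]] := proper_mul_solvel u a0.
have bal x : m b (m a x) = x *+ (k * l).
  by rewrite mulA ba proper_mulMnl ul mulrnA.
have kl_gt0 : (0 < k * l)%N by rewrite muln_gt0 k_gt0.
have b0 : b <> 0.
  move=> b0; apply: u0; apply: (rVint_mulrn_eq0 l_gt0).
  by rewrite -ba b0 proper_mul0l.
exists b, (k * l)%N; split=> // x.
have [r [y [r_gt0 ay]]] := proper_mul_solver x a0.
apply: (rVint_mulrnI r_gt0).
by rewrite -!proper_mulMnr -ay bal proper_mulMnr ay mulrnAC.
Qed.

End ProperMultiplication.

(** * Vectors avoiding finitely many subspaces and points *)

Lemma eventually_avoid (I : eqType) (r : seq I) (P : I -> nat -> Prop) :
  (forall i, i \in r -> forall s t, P i s -> P i t -> s = t) ->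
  exists M, forall t, (M <= t)%N -> forall i, i \in r -> ~ P i t.
Proof.
elim: r => [|i r IHr] P_inj; first by exists 0%N.
have [|M avoidM] := IHr; first by move=> j rj; apply: P_inj; rewrite inE rj orbT.
have [[s Pis]|noP] := pselect (exists s, P i s); last first.
  exists M => t leMt j /[!inE] /predU1P[-> Pit|]; last exact: avoidM.
  by apply: noP; exists t.
exists (maxn M s.+1) => t /[!geq_max] /andP[leMt lt_st] j.
rewrite inE => /predU1P[-> Pit|]; last exact: avoidM.
by move: lt_st; rewrite (P_inj i _ s t) ?inE ?eqxx ?ltnn.
Qed.

(** In the integer lattice, these are the traces of the rational subspaces. *)
Definition pure_subgroup (V : zmodType) (W : set V) : Prop :=
  [/\ W 0, forall x y, W x -> W y -> W (x - y)
    & forall n x, (0 < n)%N -> W (x *+ n) -> W x].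

Lemma pure_subgroupMn (V : zmodType) (W : set V) x n :
  pure_subgroup W -> W x -> W (x *+ n).
Proof.
move=> [W0 WB _] Wx; have WN : W (- x) by rewrite -sub0r; apply: WB.
elim: n => [|n IHn]; first by rewrite mulr0n.
by rewrite mulrSr -[x in _ + x]opprK; apply: WB.
Qed.

(* If [W i] contains the vector [x] already found but not [y], then no [y + t x]
   lies in [W i], and each of the other subgroups contains at most one. *)
Lemma avoid_pure_subgroups (V : zmodType) (I : eqType) (r : seq I)
    (W : I -> set V) :
  (forall i, i \in r -> pure_subgroup (W i)) ->
  (forall i, i \in r -> exists x, ~ W i x) ->
  exists x, forall i, i \in r -> ~ W i x.
Proof.
elim: r => [|i r IHr] pureW properW; first by exists 0.
have pure_r j : j \in r -> pure_subgroup (W j).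
  by move=> rj; apply: pureW; rewrite inE rj orbT.
have pure_i : pure_subgroup (W i) by apply: pureW; rewrite inE eqxx.
have [|x xW] := IHr pure_r.
  by move=> j rj; apply: properW; rewrite inE rj orbT.
have [Wix|nWix] := pselect (W i x); last first.
  by exists x => j /[!inE] /predU1P[->|/xW].
have [|y nWiy] := properW i; first by rewrite inE eqxx.
have [|M avoidM] := @eventually_avoid I r (fun j t => W j (y + x *+ t)).
  move=> j rj.
  (* The two vectors differ by [x *+ (t - s)], and purity would put [x] in [W j]. *)
  have lt_absurd s t : (s < t)%N -> W j (y + x *+ s) -> W j (y + x *+ t) -> False.
    have [_ WB Wdiv] := pure_r j rj.
    move=> lt_st Ws Wt; apply: (xW j rj); apply: (Wdiv (t - s)%N).
      by rewrite subn_gt0.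
    by rewrite mulrnBr 1?ltnW // -(addrKA y) opprD addrA addrAC -addrA -opprD
      ![_ + y]addrC; apply: WB.
  move=> s t Ws Wt; case: (ltngtP s t) => // lt_st.
    by case: (lt_absurd _ _ lt_st Ws Wt).
  by case: (lt_absurd _ _ lt_st Wt Ws).
exists (y + x *+ M) => j /[!inE] /predU1P[->|]; last exact: avoidM.
move=> Wy; apply: nWiy; rewrite -(addrK (x *+ M) y).
by case: (pure_i) => _ WB _; apply: WB => //; apply: pure_subgroupMn.
Qed.

(** Only the proper [W i] matter; the zero subgroup, indexed by [None], joins them to keep [x]
    nonzero. By purity all positive multiples of [x] still avoid them, and a large one also misses
    the sets [Q j]. *)
Lemma generic_vector d (I J : eqType) (r : seq I) (s : seq J)
    (W : I -> set 'rV[int]_d) (Q : J -> set 'rV[int]_d) :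
  (0 < d)%N ->
  (forall i, i \in r -> pure_subgroup (W i)) ->
  (forall j, j \in s -> forall x y, Q j x -> Q j y -> x = y) ->
  exists x, [/\ x <> 0, forall i, i \in r -> W i x -> forall y, W i y
    & forall j, j \in s -> ~ Q j x].
Proof.
move=> d_gt0 pureW Qinj.
pose r' := [seq i <- r | `[< exists x, ~ W i x >]].
pose W' (i : option I) : set 'rV[int]_d := if i is Some i then W i else [set 0].
have r'P i : i \in r' -> i \in r /\ exists x, ~ W i x.
  by rewrite mem_filter => /andP[/asboolP].
have [||x xW] := @avoid_pure_subgroups _ _ (None :: map Some r') W'.
- move=> i /[!inE] /predU1P[->|/mapP[j /r'P[rj _] ->]]; last exact: pureW.
  split=> //= [x y -> ->|n x n_gt0]; first by rewrite subrr.
  exact: rVint_mulrn_eq0.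
- move=> i /[!inE] /predU1P[->|/mapP[j /r'P[_ Wj] ->]] //.
  exact: rVint_neq0_ex.
have x0 : x <> 0 by apply: (xW None); rewrite inE eqxx.
have [|M avoidM] := @eventually_avoid J s (fun j t => Q j (x *+ t.+1)).
  move=> j sj t1 t2 Q1 Q2.
  by have [] := rVint_mulrn_inj x0 (Qinj j sj _ _ Q1 Q2).
exists (x *+ M.+1); split=> [|i ri Wx y|j sj]; last exact: avoidM.
  by move/(rVint_mulrn_eq0 (ltn0Sn M)).
apply: contrapT => nWy; apply: (xW (Some i)).
  rewrite inE /= map_f // mem_filter ri andbT.
  by apply/asboolP; exists y.
by case: (pureW i ri) => _ _; apply; first exact: (ltn0Sn M).
Qed.

(** * Piecewise syndetic and thick sets *)

Lemma piecewise_syndetic_sub T (S : set T) op (A B : set T) :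
  A `<=` B -> piecewise_syndetic S op A -> piecewise_syndetic S op B.
Proof.
move=> sAB [k [s [Ss thickA]]]; exists k, s; split=> // F finF sFS.
have [x Sx FxA] := thickA F finF sFS; exists x => //.
move=> z /FxA[i _ [Sz Asz]]; exists i => //; split=> //; exact: sAB.
Qed.

(** If [A] were not piecewise syndetic for [op2], its complement would lie in the common class and
    so have to meet [A]. *)
Lemma PSstar_eq_piecewise_syndetic T (S : set T) op1 op2 (A : set T) :
  PSstar S op1 = PSstar S op2 -> A `<=` S ->
  piecewise_syndetic S op1 A -> piecewise_syndetic S op2 A.
Proof.
move=> eqPS sAS psA; apply: contrapT => npsA.
have : PSstar S op2 (S `\` A).
  split=> [x []//|B sBS psB]; apply: contrapT => disj; apply: npsA.
  apply: piecewise_syndetic_sub psB => x Bx; apply: contrapT => nAx.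
  by apply: disj; exists x; do !split=> //; apply: sBS.
by rewrite -eqPS => -[_ /(_ A sAS psA)[x [[]]]].
Qed.

Lemma piecewise_syndetic_eq_PSstar T (S : set T) op1 op2 :
  (forall A, piecewise_syndetic S op1 A <-> piecewise_syndetic S op2 A) ->
  PSstar S op1 = PSstar S op2.
Proof.
move=> eqPS; apply/seteqP; split=> A [sAS meetA];
  by split=> // B sBS /eqPS; apply: meetA.
Qed.

Lemma thick_avoid d m (B : set 'rV[int]_d) (F G : seq 'rV[int]_d) :
  (0 < d)%N -> proper_mul m -> (forall f, f \in F -> f <> 0) ->
  thick (@nonzero_vecs d) m B ->
  exists y, [/\ y <> 0, y \notin G & forall f, f \in F -> B (m f y)].
Proof.
move=> d_gt0 hm F0 thickB; have [z z0] := rVint_neq0_ex d_gt0.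
have zt0 t : z *+ t.+1 <> 0 by move/(rVint_mulrn_eq0 (ltn0Sn t)).
(* One candidate [m (z *+ t.+1) x] more than [G] has elements, so one of them falls outside [G]. *)
pose ts := iota 0 (size G).+1.
have [||x x0 FxB] := thickB [set` [seq m f (z *+ t.+1) | f <- F, t <- ts]].
- exact: finite_seq.
- by move=> _ /allpairsP[[f t] /= [/F0 f0 _ ->]]; apply: proper_mul_neq0.
have [t ts_t tG] : exists2 t, t \in ts & m (z *+ t.+1) x \notin G.
  apply/hasP; rewrite has_predC; apply/negP => /allP allG.
  suff: (size [seq m (z *+ t.+1) x | t <- ts] <= size G)%N.
    by rewrite size_map size_iota ltnn.
  apply: uniq_leq_size => [|_ /mapP[t ts_t ->]]; last exact: allG.
  rewrite map_inj_uniq ?iota_uniq // => s t /(proper_mulIl hm x0).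
  by case/(rVint_mulrn_inj z0).
exists (m (z *+ t.+1) x); split=> // [|f Ff].
  exact: (proper_mul_neq0 hm (zt0 t)).
apply: FxB; exists (m f (z *+ t.+1)); last by rewrite (proper_mulA hm).
by apply/allpairsP; exists (f, t).
Qed.

(** * Finite sets exhausting the nonzero vectors *)

Section Enumeration.

Variable d : nat.
Local Notation V := 'rV[int]_d.

Definition box (n : nat) : seq V :=
  [seq x <- pmap (@unpickle V) (iota 0 n) | x != 0].

Lemma box_neq0 n x : x \in box n -> x <> 0.
Proof. by rewrite mem_filter => /andP[/eqP]. Qed.

Lemma subset_box n p : (n <= p)%N -> {subset box n <= box p}.
Proof.
move=> le_np x; rewrite !mem_filter => /andP[-> /=]; rewrite !mem_pmap.
move=> /mapP[i i_n ->]; apply: map_f.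
by move: i_n; rewrite !mem_iota !add0n /= => /leq_trans; apply.
Qed.

Lemma mem_box_pickle (x : V) : x <> 0 -> x \in box (pickle x).+1.
Proof.
move=> /eqP x0; rewrite mem_filter x0 mem_pmap -(pickleK x).
by rewrite map_f // mem_iota /= add0n.
Qed.

Lemma sub_box (F : seq V) :
  (forall f, f \in F -> f <> 0) -> exists n, {subset F <= box n}.
Proof.
move=> F0; exists (\max_(f <- F) (pickle f).+1)%N => f Ff.
by apply: subset_box (mem_box_pickle (F0 f Ff)); apply: leq_bigmax_seq.
Qed.

End Enumeration.

(** * Construction of the sparse sequence *)

Section SparseSequence.

Variables (d : nat) (m o : 'rV[int]_d -> 'rV[int]_d -> 'rV[int]_d).
Hypotheses (d_gt0 : (0 < d)%N) (hm : proper_mul m) (ho : proper_mul o).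
Local Notation V := 'rV[int]_d.

(* Over the rationals, this is the kernel of
   [L'(b1)^-1 L(f1) - L'(b2)^-1 L(f2)], where [L] and [L'] are the left
   multiplications of [m] and [o]. *)
Definition proportional (i : (V * V) * (V * V)) : set V :=
  [set x | exists y n, [/\ (0 < n)%N, o i.1.2 y = m i.1.1 x *+ n
                         & o i.2.2 y = m i.2.1 x *+ n]].

Lemma pure_proportional i : pure_subgroup (proportional i).
Proof.
split=> [|x x' [y [n [n_gt0 y1 y2]]] [y' [n' [n'_gt0 y'1 y'2]]]|k x k_gt0].
- by exists 0, 1%N; rewrite !(proper_mul0r hm) !(proper_mul0r ho).
- exists (y *+ n' - y' *+ n), (n * n')%N; rewrite muln_gt0 n_gt0 n'_gt0.
  rewrite !(proper_mulBr ho) !(proper_mulMnr ho) y1 y2 y'1 y'2.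
  by rewrite !(proper_mulBr hm) !mulrnBl -!mulrnA [(n' * n)%N]mulnC.
- move=> [y [n [n_gt0 y1 y2]]]; exists y, (k * n)%N.
  by rewrite muln_gt0 k_gt0 n_gt0 y1 y2 !(proper_mulMnr hm) !mulrnA.
Qed.

Lemma sparse_sequence : exists x : nat -> V, forall n,
  [/\ x n <> 0,
      forall f1 b1 f2 b2, f1 \in box d n -> b1 \in box d n ->
        f2 \in box d n -> b2 \in box d n ->
        proportional ((f1, b1), (f2, b2)) (x n) ->
        forall z, proportional ((f1, b1), (f2, b2)) z
    & forall k, (k < n)%N -> forall f1 b1 f2 b2 y,
        f1 \in box d n -> b1 \in box d n ->
        f2 \in box d n -> b2 \in box d n ->
        o b1 y = m f1 (x k) -> o b2 y <> m f2 (x n)].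
Proof.
pose good n (xs : seq V) (x : V) := [/\ x <> 0,
  forall f1 b1 f2 b2, f1 \in box d n -> b1 \in box d n ->
    f2 \in box d n -> b2 \in box d n ->
    proportional ((f1, b1), (f2, b2)) x ->
    forall z, proportional ((f1, b1), (f2, b2)) z
  & forall x', x' \in xs -> forall f1 b1 f2 b2 y,
    f1 \in box d n -> b1 \in box d n -> f2 \in box d n -> b2 \in box d n ->
    o b1 y = m f1 x' -> o b2 y <> m f2 x].
have goodP xs : exists x, good (size xs) xs x.
  set n := size xs.
  pose r1 := [seq (f, b) | f <- box d n, b <- box d n].
  pose r := [seq (p, q) | p <- r1, q <- r1].
  have r1P f b : f \in box d n -> b \in box d n -> (f, b) \in r1.
    by move=> fn bn; apply/allpairsP; exists (f, b).
  have rP p q : p \in r1 -> q \in r1 -> (p, q) \in r.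
    by move=> pr qr; apply/allpairsP; exists (p, q).
  pose Q (j : ((V * V) * (V * V)) * V) : set V :=
    [set x | exists y, o j.1.1.2 y = m j.1.1.1 j.2 /\ o j.1.2.2 y = m j.1.2.1 x].
  have [||x [x0 xW xQ]] :=
      @generic_vector d _ _ r [seq (p, x') | p <- r, x' <- xs] proportional Q d_gt0.
  - by move=> i _; apply: pure_proportional.
  (* Cancelling [b1] makes [y] unique, and cancelling [f2] then makes the point unique. *)
  - move=> _ /allpairsP[[[p q] x'] /= [pq_r _ ->]] x z /= [y [y1 y2]] [y' [y'1 y'2]].
    case/allpairsP: pq_r => -[p' q'] /= [/allpairsP[[f1 b1] /= [_ b1n ->]]].
    move=> /allpairsP[[f2 b2] /= [f2n _ ->]] [? ?]; subst p q.
    have eq_y : y = y'.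
      by apply: (proper_mulIr ho (box_neq0 b1n)); rewrite y1 y'1.
    by apply: (proper_mulIr hm (box_neq0 f2n)); rewrite -y2 -y'2 eq_y.
  exists x; split=> // [f1 b1 f2 b2 f1n b1n f2n b2n|x' xs' f1 b1 f2 b2 y f1n b1n f2n b2n y1 y2].
    by apply: xW; rewrite rP ?r1P.
  apply: (xQ (((f1, b1), (f2, b2)), x')); last by exists y.
  by apply/allpairsP; exists (((f1, b1), (f2, b2)), x'); rewrite rP ?r1P.
have [G GP] := choice goodP.
(* Course-of-values recursion: [l n] lists the first [n] terms. *)
pose l := fix l n : seq V := if n is n'.+1 then rcons (l n') (G (l n')) else [::].
have size_l n : size (l n) = n by elim: n => //= n IHn; rewrite size_rcons IHn.
have mem_l k n : (k < n)%N -> G (l k) \in l n.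
  elim: n => // n IHn; rewrite ltnS leq_eqVlt mem_rcons inE.
  by case/predU1P=> [->|/IHn ->]; rewrite ?eqxx ?orbT.
exists (fun n => G (l n)) => n; have := GP (l n); rewrite size_l => -[x0 xW xQ].
by split=> // k lt_kn; apply: xQ; apply: mem_l.
Qed.

End SparseSequence.

(** * Comparing the left translations of the two multiplications *)

Section LeftTranslations.

Variables (d : nat) (m o : 'rV[int]_d -> 'rV[int]_d -> 'rV[int]_d).
Hypotheses (d_gt0 : (0 < d)%N) (hm : proper_mul m) (ho : proper_mul o).
Local Notation V := 'rV[int]_d.
Local Notation S := (@nonzero_vecs d).

Definition sparse_set (x : nat -> V) : set V :=
  [set z | exists n f, f \in box d n /\ z = m f (x n)].

Lemma sparse_set_neq0 x : (forall n, x n <> 0) -> sparse_set x `<=` S.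
Proof.
by move=> x0 _ [n [f [/box_neq0 f0 ->]]]; apply: (proper_mul_neq0 hm f0).
Qed.

(** One quotient suffices: for finite [F], the set [m s F] lies in some [box d n], and [x n] is the
    required translate. *)
Lemma piecewise_syndetic_sparse_set x :
  (forall n, x n <> 0) -> piecewise_syndetic S m (sparse_set x).
Proof.
move=> x0; have [s s0] := rVint_neq0_ex d_gt0.
exists 1%N, (fun=> s); split=> // F /finite_seqP[F' ->] F0.
have [|n sFn] := @sub_box d (map (m s) F').
  by move=> _ /mapP[f /F0 f0 ->]; apply: proper_mul_neq0.
exists (x n); first exact: x0.
move=> _ [f Ff <-]; exists ord0 => //; split.
  exact: (proper_mul_neq0 hm (F0 f Ff)).
by exists n, (m s f); rewrite (proper_mulA hm) sFn ?map_f.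
Qed.

Hypothesis sub_PS : forall A, A `<=` S ->
  piecewise_syndetic S m A -> piecewise_syndetic S o A.

(** The conclusion reads [L'(s_i f) L'(s_j f0)^-1 = L(p) L(p0)^-1], where [i] and [j] range over a
    finite set independent of [f] and [f0]. *)
Lemma sparse_hits : exists k (s : 'I_k -> V), (forall i, s i <> 0) /\
  forall f f0 : V, f <> 0 -> f0 <> 0 -> exists i j p p0,
    p0 <> 0 /\ forall z, proportional m o ((p0, o (s j) f0), (p, o (s i) f)) z.
Proof.
have [x xP] := sparse_sequence d_gt0 hm ho.
have x0 n : x n <> 0 by have [] := xP n.
have [k [s [s0 thick_s]]] :=
  sub_PS (sparse_set_neq0 x0) (piecewise_syndetic_sparse_set x0).
exists k, s; split=> // f f0 f_neq0 f0_neq0.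
pose bs := [seq o (s i) f | i <- enum 'I_k] ++ [seq o (s i) f0 | i <- enum 'I_k].
have bs0 b : b \in bs -> b <> 0.
  rewrite mem_cat => /orP[] /mapP[i _ ->]; apply: (proper_mul_neq0 ho) => //;
  exact: s0.
have [N sN] := sub_box bs0.
have bsf i : o (s i) f \in bs by rewrite mem_cat map_f ?mem_enum.
have bsf0 i : o (s i) f0 \in bs by rewrite mem_cat orbC map_f ?mem_enum.
(* The vectors [y] for which some [o b y] lies in one of the first [N] layers of
   the sparse set form a finite set, which thickness allows us to avoid. *)
pose As := [seq m p (x n) | n <- iota 0 N, p <- box d n].
(* [g (b, z)] is the solution of [o b y = z], unique by cancellation, with default [0] if there is
   none. *)
have [g gP] : {g : V * V -> V & forall bz y, bz.1 <> 0 -> o bz.1 y = bz.2 -> y = g bz}.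
  apply: (@choice _ _ (fun bz z => forall y, bz.1 <> 0 -> o bz.1 y = bz.2 -> y = z)).
  move=> [b z] /=; have [[y yz]|nz] := pselect (exists y, o b y = z).
    by exists y => y' b0; rewrite -yz; apply: proper_mulIr.
  by exists 0 => y _ yz; case: nz; exists y.
have [|y [y0 yG hit]] := @thick_avoid d o _ [:: f; f0]
    [seq g (b, z) | b <- bs, z <- As] d_gt0 ho _ thick_s.
  by move=> f1; rewrite !inE => /orP[]/eqP->.
have hitP b n p : b \in bs -> p \in box d n -> o b y = m p (x n) -> (N <= n)%N.
  move=> bbs pn oby; rewrite leqNgt; apply/negP => lt_nN; case/negP: yG.
  apply/allpairsP; exists (b, m p (x n)); split=> //=; last first.
    by apply: gP => //; apply: bs0.
  by apply/allpairsPdep; exists n, p; rewrite mem_iota.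
have [|i _ [_ [n [p [pn hp]]]]] := hit f; first by rewrite inE eqxx.
have [|j _ [_ [n0 [p0 [p0n hp0]]]]] := hit f0; first by rewrite !inE eqxx orbT.
rewrite (proper_mulA ho) in hp; rewrite (proper_mulA ho) in hp0.
have leNn := hitP _ _ _ (bsf i) pn hp; have leNn0 := hitP _ _ _ (bsf0 j) p0n hp0.
have sNn q l : (N <= l)%N -> q \in bs -> q \in box d l.
  by move=> leNl /sN; apply: subset_box.
exists i, j, p, p0; split; first exact: box_neq0 p0n.
(* Distinct layers contradict the separation clause at the larger index; in a common layer,
   genericity of [x n] spreads the relation to all vectors. *)
case: (ltngtP n n0) => [lt_n|lt_n|eq_n].
- have [_ _ /(_ n lt_n p _ p0 _ y)] := xP n0.
  case/(_ _ _ _ _ _ _ hp hp0) => //; try by apply: sNn.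
  exact: (subset_box (ltnW lt_n)).
- have [_ _ /(_ n0 lt_n p0 _ p _ y)] := xP n.
  case/(_ _ _ _ _ _ _ hp0 hp) => //; try by apply: sNn.
  exact: (subset_box (ltnW lt_n)).
- move: eq_n p0n hp0 leNn0 => <- p0n hp0 _; have [_ xW _] := xP n.
  apply: xW => //; try by apply: sNn.
  by exists y, 1%N.
Qed.

Lemma left_translations_commensurable g :
  exists a n, (0 < n)%N /\ forall y, o g y *+ n = m a y.
Proof.
have [k [s [s0 hits]]] := sparse_hits.
have [f0 f0_neq0] := rVint_neq0_ex d_gt0.
pose U (ij : 'I_k * 'I_k) : set V := [set f | exists a n, (0 < n)%N /\
  forall y, o (o (s ij.1) f) y *+ n = m a (o (o (s ij.2) f0) y)].
have pureU ij : pure_subgroup (U ij).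
  split=> [|f f' [a [n [n_gt0 fa]]] [a' [n' [n'_gt0 fa']]]|l f l_gt0 [a [n [n_gt0 fa]]]].
  - exists 0, 1%N; split=> // y.
    by rewrite (proper_mul0r ho) (proper_mul0l ho) (proper_mul0l hm).
  - exists (a *+ n' - a' *+ n), (n * n')%N; rewrite muln_gt0 n_gt0 n'_gt0.
    split=> // y; rewrite (proper_mulBr ho) (proper_mulBl ho y) (proper_mulBl hm).
    by rewrite !(proper_mulMnl hm) -fa -fa' mulrnBl -!mulrnA [(n' * n)%N]mulnC.
  - exists a, (l * n)%N; rewrite muln_gt0 l_gt0 n_gt0; split=> // y.
    by rewrite -fa (proper_mulMnr ho) (proper_mulMnl ho) mulrnA.
have coverU f : f <> 0 -> exists ij, U ij f.
  move=> f_neq0; have [i [j [p [p0 [p0_neq0 prop]]]]] := hits f f0 f_neq0 f0_neq0.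
  exists (i, j); rewrite /U /=; set b := o (s j) f0.
  have b0 : b <> 0 by apply: (proper_mul_neq0 ho) => //; apply: s0.
  (* Evaluating the relation at [m q (o b y)] turns [L(p) L(p0)^-1] into [L(m p q)], up to a
     rational factor. *)
  have [q [M [M_gt0 _ p0q _]]] := proper_mul_quasi_inv hm p0_neq0.
  exists (m p q), M; split=> // y.
  have [y' [n [n_gt0 /= by' sfy']]] := prop (m q (o b y)).
  have y'E : y' = y *+ (M * n).
    by apply: (proper_mulIr ho b0); rewrite by' p0q (proper_mulMnr ho) mulrnA.
  apply: (rVint_mulrnI n_gt0).
  by rewrite -(proper_mulA hm) -sfy' y'E (proper_mulMnr ho) mulrnA.
have [[i j] Uij] : exists ij, forall f, U ij f.
  apply: contrapT => properU.
  have [//|ij _|f fU] := @avoid_pure_subgroups _ _ (enum {: 'I_k * 'I_k}) U.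
    by apply: contrapT => Uij; apply: properU; exists ij => f; apply: contrapT => nUf;
      apply: Uij; exists f.
  have [f_eq0|/coverU[ij Uf]] := pselect (f = 0).
    have [ij _] := coverU f0 f0_neq0; apply: (fU ij); first by rewrite mem_enum.
    by rewrite f_eq0; case: (pureU ij).
  by apply: (fU ij); rewrite ?mem_enum.
(* Up to rational factors, [L'(s i) L'(f) = L(a) L'(c)] for every [f]; taking
   for [f] the inverse of [s i] shows that [L'(c)] is itself some [L(b)]. *)
set c := o (s j) f0.
have [h [M [M_gt0 _ sh _]]] := proper_mul_quasi_inv ho (s0 i).
have [a1 [n1 [n1_gt0 a1P]]] := Uij h.
have a1_neq0 : a1 <> 0.
  move=> a1_eq0; apply: f0_neq0; apply: (rVint_mulrn_eq0 M_gt0).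
  apply: (rVint_mulrn_eq0 n1_gt0).
  by rewrite -sh (proper_mulA ho) a1P a1_eq0 (proper_mul0l hm).
have [b [l [l_gt0 _ _ ba1]]] := proper_mul_quasi_inv hm a1_neq0.
have cE y : o c y *+ l = m b y *+ (M * n1).
  by rewrite -ba1 -a1P -(proper_mulA ho) sh -mulrnA (proper_mulMnr hm).
(* Since [s i] cancels [h], this gives [L'(g) = L(a) L'(c)] up to rational factors, and [cE]
   replaces [L'(c)] by [L(b)]. *)
have [a [n [n_gt0 aP]]] := Uij (o h g).
exists (m a b *+ (M * n1)), (M * n * l)%N.
rewrite !muln_gt0 M_gt0 n_gt0 l_gt0; split=> // y.
rewrite (proper_mulMnl hm) -(proper_mulA hm) -(proper_mulMnr hm) -cE.
rewrite (proper_mulMnr hm) -aP !(mulrnA _ _ l); congr (_ *+ _).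
by rewrite mulrnA -sh !(proper_mulA ho).
Qed.

(** If [L'(g)] is proportional to some [L(b)], evaluation at the quasi-unit [u] of [m] identifies
    [b] as a multiple of [o g u]. Taking [g = o x w], with [w] a quasi-inverse of [u] for [o], makes
    [b] a multiple of [x]. *)
Lemma left_translations_isotopy :
  exists v w : V, [/\ v <> 0, w <> 0 & forall x y, m (m x v) y = o (o x w) y].
Proof.
have [a a0] := rVint_neq0_ex d_gt0.
have [u [n [n_gt0 u0 ul ur]]] := proper_mul_quasi_unit hm a0.
have ouE g y : o g y *+ n = m (o g u) y.
  have [b [N [N_gt0 gb]]] := left_translations_commensurable g.
  apply: (rVint_mulrnI N_gt0); rewrite mulrnAC gb -!(proper_mulMnl hm).
  by rewrite gb ur.
have [u' [n' [n'_gt0 u'0 _ u'r]]] := proper_mul_quasi_unit ho a0.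
have [k [w [k_gt0 wu]]] := proper_mul_solvel ho u' u0.
have w0 : w <> 0.
  move=> w_eq0; apply: u'0; apply: (rVint_mulrn_eq0 k_gt0).
  by rewrite -wu w_eq0 (proper_mul0l ho).
(* These factors make both sides equal to [m x y *+ (n * n' * k)]. *)
exists (u *+ (n' * k)), (w *+ (n * n)); split.
- by apply: contra_not u0; apply: rVint_mulrn_eq0; rewrite muln_gt0 n'_gt0.
- by apply: contra_not w0; apply: rVint_mulrn_eq0; rewrite muln_gt0 n_gt0.
- move=> x y; rewrite (proper_mulMnr hm) (proper_mulMnr ho) !proper_mulMnl //.
  rewrite ur (proper_mulMnl hm) [RHS]mulrnA ouE -(proper_mulA ho) wu.
  by rewrite (proper_mulMnr ho) u'r !(proper_mulMnl hm) -!mulrnA mulnC mulnA.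
Qed.

End LeftTranslations.

(** * From the identity to equal classes *)

(** Two uses of the identity turn the [m]-product [s v f v x] into the [o]-product [s w f w x].
    Hence thickness is applied to the vectors [v f v], the translators become [o s w], and the point
    becomes [o w x]. *)
Lemma isotopic_piecewise_syndetic d (m o : 'rV[int]_d -> 'rV[int]_d -> 'rV[int]_d)
    (v w : 'rV[int]_d) (A : set 'rV[int]_d) :
  proper_mul m -> proper_mul o -> v <> 0 -> w <> 0 ->
  (forall x y, x <> 0 -> y <> 0 -> m (m x v) y = o (o x w) y) ->
  piecewise_syndetic (@nonzero_vecs d) m A -> piecewise_syndetic (@nonzero_vecs d) o A.
Proof.
move=> hm ho v0 w0 vw [k [s [s0 thickA]]].
exists k, (fun i => o (s i) w); split.
  by move=> i; apply: (proper_mul_neq0 ho) => //; apply: s0.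
move=> F finF F0.
have [||x x0 FxA] := thickA [set m (m v f) v | f in F].
- exact: finite_image.
- by move=> _ [f /F0 f0 <-]; do !apply: (proper_mul_neq0 hm).
exists (o w x); first exact: (proper_mul_neq0 ho w0).
move=> _ [f Ff <-]; have f0 := F0 f Ff.
have [|i _ [_ Ai]] := FxA (m (m (m v f) v) x).
  by exists (m (m v f) v) => //; exists f.
exists i => //; split; first by do !apply: (proper_mul_neq0 ho).
have si0 := s0 i; have sw0 := proper_mul_neq0 ho si0 w0.
suff <- : m (s i) (m (m (m v f) v) x) = o (o (s i) w) (o f (o w x)) by [].
rewrite !(proper_mulA hm) !(proper_mulA ho) -(vw (s i)) // -vw //.
by do !apply: (proper_mul_neq0 hm).
Qed.

Theorem theoremA (d : nat) (hd : (0 < d)%N)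
    (m o : 'rV[int]_d -> 'rV[int]_d -> 'rV[int]_d)
    (hm : proper_mul m) (ho : proper_mul o) :
  PSstar (@nonzero_vecs d) m = PSstar (@nonzero_vecs d) o <->
  exists v w : 'rV[int]_d, [/\ nonzero_vecs v, nonzero_vecs w &
    forall x y : 'rV[int]_d, nonzero_vecs x -> nonzero_vecs y ->
      m (m x v) y = o (o x w) y].
Proof.
split=> [eqPS|[v [w [v0 w0 vw]]]].
  have [v [w [v0 w0 vw]]] := left_translations_isotopy hd hm ho
    (fun A => PSstar_eq_piecewise_syndetic eqPS).
  by exists v, w.
apply: piecewise_syndetic_eq_PSstar => A; split.
  exact: isotopic_piecewise_syndetic vw.
by apply: (@isotopic_piecewise_syndetic _ _ _ w v) => // x y x0 y0; rewrite vw.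
Qed.
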